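(* Let $q=p^k$ be an odd prime power ($p$ an odd prime) with $k>1$. Then the affine group $AGL(1,q)=\mathbb{F}_q\rtimes\mathbb{F}_q^\times$ is not SEP.
   Context: $AGL(1,q)$ is the group of permutations of $\mathbb{F}_q$ of the form $z\mapsto az+b$ with $a\in\mathbb{F}_q^\times$, $b\in\mathbb{F}_q$. Representations are nonzero, finite-dimensional, over $\mathbb{C}$. A finite group $G$ is called SEP if for every pair of noncommuting elements $x,y\in G$ there exists a representation $\rho$ of $G$ such that $\rho(x)$ and $\rho(y)$ do not share a common eigenvector. *)

(* Defs.v *)
From HB Require Import structures.
From mathcomp Require Import all_boot all_order all_algebra all_fingroup all_solvable.
From mathcomp Require Import all_character.
From mathcomp Require Import reals.
From mathcomp Require Import complex.

Set Implicit Arguments.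
Unset Strict Implicit.
Unset Printing Implicit Defensive.

Import GRing.Theory GroupScope.
Local Open Scope ring_scope.

(* In {perm F} the product s * t is "s, then t", so s |-> (v |-> v *m rho s)
   below is a representation for the usual composition order as well. *)
Definition AGL1 (F : finFieldType) : {set {perm F}} :=
  [set s : {perm F} | [exists a : F, exists b : F,
     (a != 0) && [forall z : F, s z == a * z + b]]].

Lemma AGL1P (F : finFieldType) (s : {perm F}) :
  reflect (exists a b : F, a != 0 /\ forall z, s z = a * z + b) (s \in AGL1 F).
Proof.
rewrite inE; apply: (iffP existsP) => [[a /existsP[b /andP[a0 /forallP H]]]|].
  by exists a, b; split=> // z; apply/eqP.
move=> [a [b [a0 H]]]; exists a; apply/existsP; exists b; rewrite a0.
by apply/forallP=> z; rewrite H.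
Qed.

Fact AGL1_group_set (F : finFieldType) : group_set (AGL1 F).
Proof.
apply/group_setP; split=> [|s t /AGL1P[a [b [a0 Hs]]] /AGL1P[c [d [c0 Ht]]]].
  by apply/AGL1P; exists 1, 0; split=> [|z]; rewrite ?oner_neq0 // perm1 mul1r addr0.
apply/AGL1P; exists (c * a), (c * b + d); split=> [|z]; first by rewrite mulf_neq0.
by rewrite permM Hs Ht mulrDr mulrA addrA.
Qed.

Canonical AGL1_group (F : finFieldType) := Group (AGL1_group_set F).

Definition common_eigenvector (K : fieldType) (n : nat) (A B : 'M[K]_n) : Prop :=
  exists v : 'rV[K]_n, v != 0 /\
    exists a b : K, v *m A = a *: v /\ v *m B = b *: v.

(* R[i] is the field of complex numbers: realType is categorical. *)
Definition SEP (R : realType) (gT : finGroupType) (G : {group gT}) : Prop :=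
  forall x y : gT, x \in G -> y \in G -> ~ commute x y ->
  exists (n : nat) (rho : mx_representation R[i] G n),
    (0 < n)%N /\ ~ common_eigenvector (rho x) (rho y).

(* Main.v *)
(** A vector [v] that is a common eigenvector of all translations has a
    character [F -> C^*] with values in the [p]-th roots of unity. As
    [#|F| = p ^ k > p], this character is not injective, so [v] is fixed by some
    nontrivial translation. All nontrivial translations are conjugate under
    scalings, so the translation [z |-> z + 1] fixes a nonzero vector [w] as
    well. Since [z |-> - z] inverts that translation, one of [w + w'] and
    [w - w'], where [w'] is the image of [w] under [z |-> - z], is a common
    eigenvector of these two noncommuting permutations. *)

Require Import Defs.
From mathcomp Require Import all_boot all_order all_algebra all_fingroup all_solvable.
From mathcomp Require Import all_field all_character spectral.
From mathcomp Require Import reals.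
From mathcomp Require Import complex.

Set Implicit Arguments.
Unset Strict Implicit.
Unset Printing Implicit Defensive.

Import GRing.Theory.

Section AffinePerms.

Local Open Scope ring_scope.

Variable F : finFieldType.

Definition translation (b : F) : {perm F} := perm (@addIr F b).

Definition scaling (a : F) (a0 : a != 0) : {perm F} := perm (mulfI a0).

Definition negation : {perm F} := perm (@oppr_inj F).

Lemma translation_AGL1 b : translation b \in AGL1 F.
Proof.
by apply/AGL1P; exists 1, b; split=> [|z]; rewrite ?oner_neq0 // permE mul1r.
Qed.

Lemma scaling_AGL1 a (a0 : a != 0) : scaling a0 \in AGL1 F.
Proof. by apply/AGL1P; exists a, 0; split=> // z; rewrite permE addr0. Qed.

Lemma negation_AGL1 : negation \in AGL1 F.
Proof.
apply/AGL1P; exists (-1), 0.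
by split=> [|z]; rewrite ?oppr_eq0 ?oner_neq0 // permE mulN1r addr0.
Qed.

Lemma translationD a b :
  translation (a + b) = (translation a * translation b)%g.
Proof. by apply/permP=> z; rewrite permM !permE addrA. Qed.

Lemma translation0 : translation 0 = 1%g.
Proof. by apply/permP=> z; rewrite permE perm1 addr0. Qed.

(** Products act left to right, so this says that conjugating by the scaling turns the translation
    by [b] into the one by [a * b]. *)
Lemma scaling_translation a (a0 : a != 0) (b : F) :
  (scaling a0 * translation (a * b)%R)%g = (translation b * scaling a0)%g.
Proof. by apply/permP=> z; rewrite !permM !permE mulrDr. Qed.

Lemma negation_translation (b : F) :
  (negation * translation (- b)%R)%g = (translation b * negation)%g.
Proof. by apply/permP=> z; rewrite !permM !permE opprD. Qed.

Lemma negationK : (negation * negation)%g = 1%g.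
Proof. by apply/permP=> z; rewrite permM !permE opprK. Qed.

End AffinePerms.

Section FixedVector.

Local Open Scope ring_scope.

Variables (C : numClosedFieldType) (F : finFieldType) (p k : nat).
Hypotheses (p_prime : prime p) (k_gt1 : (1 < k)%N) (cardF : #|F| = (p ^ k)%N).
Variables (n : nat) (rho : mx_representation C (AGL1_group F) n).
Hypothesis n_gt0 : (0 < n)%N.

Let tr (b : F) := rho (translation b).

Let trD a b : tr (a + b) = tr a *m tr b.
Proof. by rewrite /tr translationD repr_mxM ?translation_AGL1. Qed.

(** Commuting matrices over an algebraically closed field share an eigenvector; [psi] collects the
    eigenvalues. *)
Lemma translations_common_eigenvector :
  exists2 v : 'rV[C]_n, v != 0 &
    exists psi : F -> C, forall b, v *m tr b = psi b *: v.
Proof.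
have [||v v0 /allP vP] := @spectral.common_eigenvector C n [seq tr b | b : F].
- exact: n_gt0.
- by move=> _ _ /mapP[a _ ->] /mapP[b _ ->]; rewrite /comm_mx -!trD addrC.
exists v => //.
have psiP b : exists c, v *m tr b == c *: v.
  have /sub_rVP[c ->] : (v *m tr b <= v)%MS.
    by apply: vP; apply: map_f; rewrite mem_enum.
  by exists c.
by exists (fun b => xchoose (psiP b)) => b; apply/eqP/(xchooseP (psiP b)).
Qed.

Lemma translation_fixed_vector :
  exists2 a : F, a != 0 & exists2 v : 'rV[C]_n, v != 0 & v *m tr a = v.
Proof.
have [v v0 [psi psiE]] := translations_common_eigenvector.
(* Cancelling [v] turns identities between the matrices [tr b] into identities for [psi]. *)
have scaleI : injective (fun c : C => c *: v).
  move=> c d /= /eqP; rewrite -subr_eq0 -scalerBl scaler_eq0 (negPf v0) orbF.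
  by rewrite subr_eq0 => /eqP.
have psi0 : psi 0 = 1.
  by apply: scaleI; rewrite -psiE /tr translation0 repr_mx1 mulmx1 scale1r.
have psiD a b : psi (a + b) = psi a * psi b.
  by apply: scaleI; rewrite -psiE trD mulmxA psiE -scalemxAl psiE scalerA.
have psiMn b m : psi (b *+ m) = psi b ^+ m.
  by elim: m => [|m IHm]; rewrite ?psi0 // mulrS exprS psiD IHm.
have charF : p \in [pchar F] by apply: card_finPcharP cardF p_prime.
have not_inj : ~~ injectiveb psi.
  apply/negP => inj_psi.
  (* [psi b ^+ p = psi (b *+ p) = psi 0 = 1]. An injective [psi] would thus give [p ^ k > p]
     distinct [p]-th roots of unity. *)
  have roots : all p.-unity_root (codom psi).
    apply/allP=> _ /codomP[b ->]; apply/unity_rootP.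
    by rewrite -psiMn -mulr_natr (pcharf0 charF) mulr0.
  have := max_unity_roots (prime_gt0 p_prime) roots inj_psi.
  rewrite size_codom cardF leqNgt -{1}(expn1 p).
  by rewrite ltn_exp2l ?k_gt1 ?prime_gt1.
have /injectivePn[a [b ab psi_ab]] := not_inj.
exists (a - b); first by rewrite subr_eq0.
by exists v => //; rewrite psiE psiD psi_ab -psiD subrr psi0 scale1r.
Qed.

Lemma translation1_fixed_vector : exists2 w : 'rV[C]_n, w != 0 & w *m tr 1 = w.
Proof.
have [a a0 [v v0 va]] := translation_fixed_vector.
have aV0 : a^-1 != 0 by rewrite invr_eq0.
(* Scaling by [a^-1] carries the translation by [a] to the one by [1]; its matrix is invertible, so
   the image of [v] is nonzero. *)
exists (v *m rho (scaling aV0)).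
  apply: contra_neq v0 => /(congr1 (mulmx^~ (rho (scaling aV0)^-1%g))).
  by rewrite mul0mx repr_mxK ?scaling_AGL1.
rewrite -mulmxA -repr_mxM ?scaling_AGL1 ?translation_AGL1 // -(mulVf a0).
rewrite scaling_translation repr_mxM ?scaling_AGL1 ?translation_AGL1 //.
by rewrite mulmxA va.
Qed.

Lemma negation_translation1_common_eigenvector :
  Defs.common_eigenvector (rho (negation F)) (rho (translation 1)).
Proof.
have [w w0 w1] := translation1_fixed_vector.
set N := rho (negation F).
have NN : N *m N = 1%:M.
  by rewrite -repr_mxM ?negation_AGL1 // negationK repr_mx1.
(* Moving [tr 1] past [N] turns it into [tr (-1)], the inverse of [tr 1], which also fixes [w]. *)
have wN1 : w *m N *m tr 1 = w *m N.
  have wV : w *m tr (-1) = w.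
    rewrite -{1}w1 -mulmxA -trD subrr.
    by rewrite /tr translation0 repr_mx1 mulmx1.
  rewrite -mulmxA -repr_mxM ?negation_AGL1 ?translation_AGL1 // -[1]opprK.
  rewrite negation_translation repr_mxM ?negation_AGL1 ?translation_AGL1 //.
  by rewrite mulmxA -/(tr _) wV.
(* If the sum vanishes, [w] itself has eigenvalue -1 under [N]; otherwise the sum is fixed by [N],
   as [N] is an involution. *)
have [wN|wN] := eqVneq (w + w *m N) 0.
  exists w; split=> //; exists (-1), 1; split; last by rewrite scale1r.
  by rewrite scaleN1r; apply/eqP; rewrite -addr_eq0 addrC wN.
exists (w + w *m N); split=> //; exists 1, 1; rewrite !scale1r !mulmxDl.
by rewrite -mulmxA NN mulmx1 addrC wN1 -/(tr 1) w1.
Qed.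

End FixedVector.

Theorem theorem1p1p50 (R : realType) (F : finFieldType) (p k : nat)
  (p_prime : prime p) (p_odd : odd p) (k_gt1 : 1 < k) (cardF : #|F| = p ^ k) :
  ~ SEP R (AGL1_group F).
Proof.
move=> sepF.
have charF : p \in [pchar F]%R by apply: card_finPcharP cardF p_prime.
have [|n [rho [n_gt0]]] :=
  sepF _ _ (negation_AGL1 F) (translation_AGL1 1%R).
  (* The two products send 0 to 1 and to -1. Were these equal, [p] would divide 2, against [p] being
     an odd prime. *)
  move/permP/(_ 0%R); rewrite !permM !permE oppr0 !add0r => /eqP.
  rewrite -subr_eq0 opprK -(natrD _ 1 1) -(dvdn_pcharf charF).
  move/dvdn_leq=> /(_ isT).
  by rewrite leqNgt odd_prime_gt2.
apply.
exact: (negation_translation1_common_eigenvector p_prime k_gt1 cardF).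
Qed.
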